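(* Let $\mathcal A_s=\mathbb{C}[x,y][[s]]$, $t=xy$, and $h_{s,t}=1+\sum_{i\geq1}s^it^i$. For every degree $k\in\{0,1,2\}$ there are isomorphisms of $\mathbb{C}[[s]]$-modules $$H^k_{log}(\widetilde{\mathcal P}_s)\simeq H^k_{log}(\widetilde{\mathcal P}_0)\otimes_{\mathbb{C}}\mathbb{C}[[s]],\qquad H^k_{DR-log(D_s)}\simeq H^k_{DR-log(D_0)}\otimes_{\mathbb{C}}\mathbb{C}[[s]].$$
   Context: Let $E=x\partial_x+y\partial_y$, $R=y\partial_y-x\partial_x$, extended $\mathbb{C}[[s]]$-linearly (coefficientwise in $s$) to $\mathcal A_s$. Let $D_0=\{t=0\}$ and let $D_s=\{t\,h_{s,t}=0\}$ be its formal deformation. $H^k_{log}(\widetilde{\mathcal P}_s)$ is the cohomology in degree $k$ of $\mathcal A_s\to\mathcal A_s^2\to\mathcal A_s$ (degrees $0,1,2$) with differentials $f\mapsto(Rf,-h_{s,t}Ef)$ and $(a,b)\mapsto h_{s,t}Ea+Rb$. $H^k_{DR-log(D_s)}$ is the cohomology in degree $k$ of $\mathcal A_s\to\mathcal A_s^2\to\mathcal A_s$ with differentials $f\mapsto(h_{s,t}Ef,Rf)$ and $(a,b)\mapsto h_{s,t}Eb-Ra$. $H^k_{log}(\widetilde{\mathcal P}_0)$ and $H^k_{DR-log(D_0)}$ denote the logarithmic Poisson and de Rham cohomology groups of $D_0$ over $\mathbb{C}$, i.e. the cohomologies of the complexes of $\mathbb{C}$-vector spaces $\mathcal A\to\mathcal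 A^2\to\mathcal A$ with $\mathcal A=\mathbb{C}[x,y]$ and differentials, respectively, $f\mapsto(Rf,-Ef)$, $(a,b)\mapsto Ea+Rb$, and $f\mapsto(Ef,Rf)$, $(a,b)\mapsto Eb-Ra$. *)

(* Defs.v *)
From HB Require Import structures.
From mathcomp Require Import all_boot all_order all_algebra.
From mathcomp Require Import generic_quotient ring_quotient.
From mathcomp Require Import freeg mpoly.
From mathcomp Require Import complex ring.
From mathcomp Require Import boolp reals.
Set Implicit Arguments.
Unset Strict Implicit.
Unset Printing Implicit Defensive.
Import GRing.Theory.
Local Open Scope ring_scope.

(* [fps V] is [V[[s]]]: [fcoef f n] is the coefficient of [s^n]. *)
Record fps (V : Type) := Fps { fcoef : nat -> V }.

HB.instance Definition _ (V : Type) := [isNew for @fcoef V].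
HB.instance Definition _ (V : choiceType) := [Choice of fps V by <:].

Lemma fpsP (V : Type) (f g : fps V) : fcoef f =1 fcoef g <-> f = g.
Proof. by split=> [|-> //]; case: f g => [f] [g] /= /funext ->. Qed.

Section FpsZmod.
Variable V : zmodType.
Implicit Types f g : fps V.

Definition fps_zero : fps V := Fps (fun=> 0).
Definition fps_opp f : fps V := Fps (fun n => - fcoef f n).
Definition fps_add f g : fps V := Fps (fun n => fcoef f n + fcoef g n).

Lemma fps_addA : associative fps_add.
Proof. by move=> f g h; apply/fpsP => n /=; rewrite addrA. Qed.
Lemma fps_addC : commutative fps_add.
Proof. by move=> f g; apply/fpsP => n /=; rewrite addrC. Qed.
Lemma fps_add0 : left_id fps_zero fps_add.
Proof. by move=> f; apply/fpsP => n /=; rewrite add0r. Qed.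
Lemma fps_addN : left_inverse fps_zero fps_opp fps_add.
Proof. by move=> f; apply/fpsP => n /=; rewrite addNr. Qed.

HB.instance Definition _ :=
  GRing.isZmodule.Build (fps V) fps_addA fps_addC fps_add0 fps_addN.
End FpsZmod.

Lemma sum_triangle (V : nmodType) n (F : nat -> nat -> V) :
  \sum_(i < n) \sum_(j < n - i) F i j = \sum_(k < n) \sum_(i < k.+1) F i (k - i)%N.
Proof.
elim: n => [|n IHn]; first by rewrite !big_ord0.
rewrite big_ord_recr [RHS]big_ord_recr /= -IHn subSnn big_ord_recl big_ord0 addr0.
rewrite [X in _ = _ + X]big_ord_recr /= subnn addrA; congr (_ + _).
rewrite -big_split /=; apply: eq_bigr => i _.
by rewrite subSn 1?ltnW // big_ord_recr.
Qed.

Section FpsScale.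
Variables (K : comNzRingType) (V : lmodType K).

Definition fps_one : fps K := Fps (fun n => (n == 0%N)%:R).
Definition fps_mul (a b : fps K) : fps K :=
  Fps (fun n => \sum_(i < n.+1) fcoef a i * fcoef b (n - i)%N).
Definition fps_scale (a : fps K) (f : fps V) : fps V :=
  Fps (fun n => \sum_(i < n.+1) fcoef a i *: fcoef f (n - i)%N).

Lemma fps_scaleA a b f :
  fps_scale a (fps_scale b f) = fps_scale (fps_mul a b) f.
Proof.
apply/fpsP => n /=.
pose F i j := fcoef a i *: (fcoef b j *: fcoef f (n - i - j)%N).
transitivity (\sum_(i < n.+1) \sum_(j < n.+1 - i) F i j).
  apply: eq_bigr => i _; rewrite scaler_sumr subSn ?leq_ord //.
rewrite (sum_triangle _ F); apply: eq_bigr => k _; rewrite scaler_suml.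
apply: eq_bigr => i _.
by rewrite /F scalerA -subnDA subnKC // -ltnS.
Qed.

Lemma fps_scale1 : left_id fps_one fps_scale.
Proof.
move=> f; apply/fpsP => n /=; rewrite big_ord_recl /= scale1r subn0 big1 ?addr0 //.
by move=> i _; rewrite scale0r.
Qed.

Lemma fps_scaleDr : right_distributive fps_scale +%R.
Proof.
move=> a f g; apply/fpsP => n /=; rewrite -big_split.
by apply: eq_bigr => i _; rewrite scalerDr.
Qed.

Lemma fps_scaleDl f : {morph fps_scale^~ f : a b / a + b}.
Proof.
move=> a b; apply/fpsP => n /=; rewrite -big_split.
by apply: eq_bigr => i _; rewrite scalerDl.
Qed.
End FpsScale.

Section FpsRing.
Variable K : comNzRingType.
Implicit Types a b c : fps K.

Lemma fps_mulA : associative (@fps_mul K).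
Proof. by move=> a b c; exact: (@fps_scaleA K K^o). Qed.

Lemma fps_mulC : commutative (@fps_mul K).
Proof.
move=> a b; apply/fpsP => n /=; rewrite (reindex_inj rev_ord_inj) /=.
apply: eq_bigr => i _; rewrite subSS subKn; last by rewrite -ltnS.
by rewrite mulrC.
Qed.

Lemma fps_mul1 : left_id (fps_one K) (@fps_mul K).
Proof. exact: (@fps_scale1 K K^o). Qed.

Lemma fps_mulDl : left_distributive (@fps_mul K) +%R.
Proof. by move=> a b c; exact: (@fps_scaleDl K K^o). Qed.

Lemma fps_oner_neq0 : fps_one K != 0.
Proof. by apply/eqP => /fpsP/(_ 0%N)/eqP; rewrite oner_eq0. Qed.

HB.instance Definition _ := GRing.Zmodule_isComNzRing.Build (fps K)
  fps_mulA fps_mulC fps_mul1 fps_mulDl fps_oner_neq0.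

(* The constant series, making [fps K] a [K]-algebra. *)
Definition fpsC (c : K) : fps K := Fps (fun n => if n is 0%N then c else 0).

Lemma fpsC_is_zmod_morphism : zmod_morphism fpsC.
Proof. by move=> c d; apply/fpsP => -[|n] /=; rewrite ?subr0. Qed.

Lemma fpsC_is_monoid_morphism : monoid_morphism fpsC.
Proof.
split=> [|c d]; apply/fpsP => -[|n] //=; first by rewrite big_ord1.
rewrite big_ord_recl /= mulr0 big1 ?addr0 // => i _.
by rewrite mul0r.
Qed.

HB.instance Definition _ :=
  GRing.isZmodMorphism.Build K (fps K) fpsC fpsC_is_zmod_morphism.
HB.instance Definition _ :=
  GRing.isMonoidMorphism.Build K (fps K) fpsC fpsC_is_monoid_morphism.
End FpsRing.

(* Not an instance for scalars in [K], so that [C[[s]]] is the only scalar ring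
   inferred on [fps V]. *)
HB.instance Definition _ (K : comNzRingType) (V : lmodType K) :=
  GRing.Zmodule_isLmodule.Build (fps K) (fps V)
    (@fps_scaleA K V) (@fps_scale1 K V) (@fps_scaleDr K V) (@fps_scaleDl K V).

(* The [K[[s]]]-linear extension of a [K]-linear map, coefficientwise in [s]. *)
Section FpsMap.
Variables (K : comNzRingType) (V W : lmodType K) (u : {linear V -> W}).

Definition fps_map (f : fps V) : fps W := Fps (fun n => u (fcoef f n)).

Lemma fps_map_is_linear : linear fps_map.
Proof.
move=> a f g; apply/fpsP => n /=; rewrite linearD linear_sum /=; congr (_ + _).
by apply: eq_bigr => i _; rewrite linearZ.
Qed.
HB.instance Definition _ :=
  GRing.isLinear.Build (fps K) (fps V) (fps W) *:%R fps_map fps_map_is_linear.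
End FpsMap.

Section QuotientModule.
Variables (K : pzRingType) (V : lmodType K) (W : submodClosed V).

(* The same predicate, seen as an additive subgroup. *)
Definition submod_subgroup : V -> bool := fun v => v \in W.

Lemma submod_subgroup_closed : zmod_closed submod_subgroup.
Proof.
split=> [|u v]; rewrite -!topredE /= /submod_subgroup; first exact: rpred0.
by move=> Wu Wv; rewrite -scaleN1r rpredD ?rpredZ.
Qed.
HB.instance Definition _ :=
  GRing.isZmodClosed.Build V submod_subgroup submod_subgroup_closed.

Local Notation submod_zmod := (GRing.ZmodClosed.clone V submod_subgroup _).

Definition quotmod := Quotient.quot submod_zmod.
HB.instance Definition _ := GRing.Zmodule.on quotmod.
HB.instance Definition _ := EqQuotient.on quotmod.

Local Open Scope quotient_scope.
Definition quotmod_pi (v : V) : quotmod := \pi_quotmod v.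

Lemma quotmod_piP u v : quotmod_pi u = quotmod_pi v <-> u - v \in W.
Proof.
split=> [/eqP|Wuv]; first by rewrite piE.
by apply/eqP; rewrite piE.
Qed.

Lemma quotmod_reprP v : v - repr (quotmod_pi v) \in W.
Proof. by apply/quotmod_piP; rewrite /quotmod_pi reprK. Qed.

Lemma quotmod_pi_zmod : zmod_morphism quotmod_pi.
Proof.
exact: (@pi_is_zmod_morphism V _ _ (Quotient.quot submod_zmod)).
Qed.
HB.instance Definition _ :=
  GRing.isZmodMorphism.Build V quotmod quotmod_pi quotmod_pi_zmod.

Definition quotmod_scale (a : K) (q : quotmod) : quotmod :=
  quotmod_pi (a *: repr q).

Lemma quotmod_scale_pi a v : quotmod_scale a (quotmod_pi v) = quotmod_pi (a *: v).
Proof.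
by apply/esym/quotmod_piP; rewrite -scalerBr rpredZ // quotmod_reprP.
Qed.

Lemma quotmod_piW (P : quotmod -> Prop) :
  (forall v, P (quotmod_pi v)) -> forall q, P q.
Proof. by move=> Ppi q; rewrite -[q]reprK; exact: Ppi. Qed.

Lemma quotmod_scaleA a b q :
  quotmod_scale a (quotmod_scale b q) = quotmod_scale (a * b) q.
Proof. by elim/quotmod_piW: q => v; rewrite !quotmod_scale_pi scalerA. Qed.
Lemma quotmod_scale1 : left_id 1 quotmod_scale.
Proof. by elim/quotmod_piW => v; rewrite quotmod_scale_pi scale1r. Qed.
Lemma quotmod_scaleDr : right_distributive quotmod_scale +%R.
Proof.
move=> a; elim/quotmod_piW => u; elim/quotmod_piW => v.
by rewrite -raddfD !quotmod_scale_pi scalerDr raddfD.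
Qed.
Lemma quotmod_scaleDl q : {morph quotmod_scale^~ q : a b / a + b}.
Proof.
elim/quotmod_piW: q => v a b.
by rewrite !quotmod_scale_pi scalerDl raddfD.
Qed.
HB.instance Definition _ := GRing.Zmodule_isLmodule.Build K quotmod
  quotmod_scaleA quotmod_scale1 quotmod_scaleDr quotmod_scaleDl.

Lemma quotmod_pi_scalable : scalable quotmod_pi.
Proof. by move=> a v; rewrite -quotmod_scale_pi. Qed.
HB.instance Definition _ :=
  GRing.isScalable.Build K V quotmod *:%R quotmod_pi quotmod_pi_scalable.
End QuotientModule.

Section Homology.
Variables (K : pzRingType) (U V W : lmodType K).
Variables (d : {linear U -> V}) (d' : {linear V -> W}).

Definition cocycle : V -> bool := fun v => d' v == 0.

Lemma cocycle_closed : GRing.subsemimod_closed cocycle.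
Proof.
split=> [|a v]; last by rewrite -!topredE /= /cocycle linearZ /= => /eqP ->; rewrite scaler0.
split=> [|u v]; rewrite -!topredE /= /cocycle ?linear0 //.
by rewrite linearD => /eqP -> /eqP ->; rewrite addr0.
Qed.
HB.instance Definition _ := GRing.isSubmodClosed.Build K V cocycle cocycle_closed.

Definition cocycles := {v : V | v \in cocycle}.
HB.instance Definition _ := SubChoice.on cocycles.
HB.instance Definition _ := [SubChoice_isSubLmodule of cocycles by <:].

Definition coboundary : cocycles -> bool := fun z => `[< exists u, val z = d u >].

Lemma coboundary_closed : GRing.subsemimod_closed coboundary.
Proof.
split=> [|a v]; last first.
  by move=> /asboolP[u vE]; apply/asboolP; exists (a *: u); rewrite !linearZ /= vE.
split=> [|u v]; first by apply/asboolP; exists 0; rewrite !linear0.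
move=> /asboolP[u' uE] /asboolP[v' vE]; apply/asboolP; exists (u' + v').
by rewrite !linearD /= uE vE.
Qed.
HB.instance Definition _ :=
  GRing.isSubmodClosed.Build K cocycles coboundary coboundary_closed.

Definition homology : lmodType K :=
  quotmod (GRing.SubmodClosed.clone K cocycles coboundary _).
End Homology.

(* Cochain complexes concentrated in degrees 0, 1, 2; the null maps below are the
   differentials into degree 0 and out of degree 2. *)
Record complex3 (K : pzRingType) := Complex3 {
  C0 : lmodType K;
  C1 : lmodType K;
  C2 : lmodType K;
  diff0 : {linear C0 -> C1};
  diff1 : {linear C1 -> C2};
  diff_diff : forall f, diff1 (diff0 f) = 0 }.

Definition cohomology (K : pzRingType) (X : complex3 K) (k : 'I_3) : lmodType K :=
  match val k with
  | 0%N => homology (\0 : {linear C0 X -> C0 X}) (diff0 X)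
  | 1%N => homology (diff0 X) (diff1 X)
  | _ => homology (diff1 X) (\0 : {linear C2 X -> C2 X})
  end.

Definition lmod_iso (K : pzRingType) (V W : lmodType K) : Prop :=
  exists u : {linear V -> W}, bijective u.

Section BaseChange.
Variables (K L : nzRingType) (phi : {rmorphism K -> L}) (M : lmodType K).

(* [M (x)_K L] as the free [L]-module on the symbols [m (x) 1], divided by the
   [L]-submodule generated by the relations making [m |-> m (x) 1] additive and
   [K]-linear; see [base_change_universal]. *)
Inductive tensor_relation : {freeg M / L} -> Prop :=
| TensorAdd m m' : tensor_relation (<< m + m' >> - << m >> - << m' >>)
| TensorScale k m : tensor_relation (<< k *: m >> - << phi k *g m >>).

Definition tensor_null : {freeg M / L} -> bool := fun x =>
  `[< forall S : submodClosed {freeg M / L},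
        (forall r, tensor_relation r -> r \in S) -> x \in S >].

Lemma tensor_null_closed : GRing.subsemimod_closed tensor_null.
Proof.
split=> [|a x]; last first.
  by move=> /asboolP x0; apply/asboolP => S rS; rewrite rpredZ // x0.
split=> [|x y]; first by apply/asboolP => S rS; exact: rpred0.
move=> /asboolP x0 /asboolP y0; apply/asboolP => S rS.
by rewrite rpredD // (x0, y0).
Qed.
HB.instance Definition _ :=
  GRing.isSubmodClosed.Build L {freeg M / L} tensor_null tensor_null_closed.

Definition base_change : lmodType L :=
  quotmod (GRing.SubmodClosed.clone L {freeg M / L} tensor_null _).

Definition tensor (m : M) (a : L) : base_change :=
  quotmod_pi _ << a *g m >>.

Lemma fgscaleU (R : nzRingType) (T : choiceType) (c k : R) (x : T) :
  c *: << k *g x >> = << c * k *g x >>.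
Proof. by apply/eqP/freeg_eqP => y; rewrite coeffZ !coeffU mulrA. Qed.

Lemma tensorZ a m b : a *: tensor m b = tensor m (a * b).
Proof. by rewrite -linearZ /= fgscaleU. Qed.

Lemma tensor1 m a : tensor m a = a *: tensor m 1.
Proof. by rewrite tensorZ mulr1. Qed.

Lemma tensor_relation0 x : tensor_relation x -> quotmod_pi _ x = 0 :> base_change.
Proof.
move=> xR; rewrite -(linear0 (quotmod_pi _)); apply/quotmod_piP.
by rewrite subr0; apply/asboolP => S; exact.
Qed.

Lemma tensorDr m a b : tensor m (a + b) = tensor m a + tensor m b.
Proof. by rewrite tensor1 scalerDl -!tensor1. Qed.

Lemma tensorDl m m' a : tensor (m + m') a = tensor m a + tensor m' a.
Proof.
rewrite tensor1 [tensor m a]tensor1 [tensor m' a]tensor1 -scalerDr; congr (_ *: _).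
apply/eqP; rewrite -subr_eq0 opprD addrA -!linearB /=; apply/eqP.
exact/tensor_relation0/TensorAdd.
Qed.

Lemma tensorZl k m a : tensor (k *: m) a = tensor m (a * phi k).
Proof.
rewrite tensor1 -tensorZ; congr (_ *: _).
apply/eqP; rewrite -subr_eq0 -!linearB /=; apply/eqP.
exact/tensor_relation0/TensorScale.
Qed.

Lemma base_change_ind (A : base_change -> Prop) :
  A 0 -> (forall m a x, A x -> A (tensor m a + x)) -> forall x, A x.
Proof.
move=> A0 AD; elim/quotmod_piW => v; rewrite -(freeg_sumE v).
elim: (dom v) => [|m r IHr]; first by rewrite big_nil linear0.
by rewrite big_cons linearD; exact: AD.
Qed.

Section Universal.
Variables (N : lmodType L) (u : {linear M -> N | phi \; *:%R}).

Lemma fglift_is_linear : linear (fglift u : {freeg M / L} -> N).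
Proof.
pose lft := GRing.isZmodMorphism.Build _ _ _ (@lift_is_additive L M N u).
pose g : {additive {freeg M / L} -> N} := HB.pack (fglift u) lft.
move=> a x y; rewrite -[fglift u]/(g : _ -> _) raddfD; congr (_ + _).
transitivity (g (\sum_(z <- dom x) << a * coeff z x *g z >>)); first by [].
rewrite -[in RHS](freeg_sumE x) !raddf_sum.
by apply: eq_bigr => m _; rewrite /= !liftU scalerA.
Qed.

Lemma fglift_null x : tensor_null x -> fglift u x = 0.
Proof.
pose lft := GRing.isLinear.Build _ _ _ _ _ fglift_is_linear.
pose g : {linear {freeg M / L} -> N} := HB.pack (fglift u) lft.
pose S := GRing.SubmodClosed.clone L _ (cocycle g) _.
move=> /asboolP /(_ S) xS; apply/eqP/xS => _ [m m'|k m]; rewrite -topredE /= /cocycle.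
  by rewrite !linearB /= !liftU !scale1r linearD -addrA -opprD subrr.
by rewrite linearB /= !liftU scale1r linearZ /= subrr.
Qed.

Theorem base_change_universal :
  exists2 g : {linear base_change -> N},
    (forall m a, g (tensor m a) = a *: u m) &
    forall g' : {linear base_change -> N},
      (forall m a, g' (tensor m a) = a *: u m) -> g' =1 g.
Proof.
pose lft := GRing.isLinear.Build _ _ _ _ _ fglift_is_linear.
pose f : {linear {freeg M / L} -> N} := HB.pack (fglift u) lft.
have fK q v : quotmod_pi _ v = q :> base_change -> f (repr q) = f v.
  move=> <-; apply/esym/eqP; rewrite -subr_eq0 -linearB /=.
  by apply/eqP/fglift_null; exact: quotmod_reprP.
pose g (q : base_change) := f (repr q).
have gL : linear g.
  move=> a; elim/quotmod_piW => v; elim/quotmod_piW => w.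
  by rewrite -linearP /g !(fK _ _ (erefl _)) linearP.
pose gL' := GRing.isLinear.Build _ _ _ _ _ gL.
pose G : {linear base_change -> N} := HB.pack g gL'.
have GE m a : G (tensor m a) = a *: u m.
  by rewrite /G /= /g (fK _ _ (erefl _)) /= liftU.
exists G => // G' G'E; apply: base_change_ind => [|m a x IH].
  by rewrite !linear0.
by rewrite !linearD; congr (_ + _); rewrite ?G'E ?GE.
Qed.
End Universal.

End BaseChange.

(* Both logarithmic complexes, over [C] and over [C[[s]]], have this shape, with
   [P] the operator [E], resp. [h_{s,t} E], and [Q] the operator [R]. *)
Section LogComplexes.
Variables (K : nzRingType) (V : lmodType K) (P Q : {linear V -> V}).
Hypothesis PQ : forall f, P (Q f) = Q (P f).

Definition poisson_diff0 (f : V) : V * V := (Q f, - P f).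
Definition poisson_diff1 (ab : V * V) : V := P ab.1 + Q ab.2.
Definition deRham_diff0 (f : V) : V * V := (P f, Q f).
Definition deRham_diff1 (ab : V * V) : V := P ab.2 - Q ab.1.

Lemma poisson_diff0_is_linear : linear poisson_diff0.
Proof.
by move=> a f g; rewrite /poisson_diff0 (linearP Q) (linearP P) /= opprD -scalerN.
Qed.
Lemma poisson_diff1_is_linear : linear poisson_diff1.
Proof.
move=> a f g; rewrite /poisson_diff1 (linearP P) (linearP Q).
by rewrite scalerDr addrACA.
Qed.
Lemma deRham_diff0_is_linear : linear deRham_diff0.
Proof. by move=> a f g; rewrite /deRham_diff0 (linearP Q) (linearP P). Qed.
Lemma deRham_diff1_is_linear : linear deRham_diff1.
Proof.
move=> a f g; rewrite /deRham_diff1 (linearP P) (linearP Q).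
by rewrite opprD scalerBr addrACA.
Qed.

HB.instance Definition _ :=
  GRing.isLinear.Build K V (V * V)%type *:%R poisson_diff0 poisson_diff0_is_linear.
HB.instance Definition _ :=
  GRing.isLinear.Build K (V * V)%type V *:%R poisson_diff1 poisson_diff1_is_linear.
HB.instance Definition _ :=
  GRing.isLinear.Build K V (V * V)%type *:%R deRham_diff0 deRham_diff0_is_linear.
HB.instance Definition _ :=
  GRing.isLinear.Build K (V * V)%type V *:%R deRham_diff1 deRham_diff1_is_linear.

Lemma poisson_diff_diff f : poisson_diff1 (poisson_diff0 f) = 0.
Proof. by rewrite /poisson_diff1 /= linearN /= PQ subrr. Qed.
Lemma deRham_diff_diff f : deRham_diff1 (deRham_diff0 f) = 0.
Proof. by rewrite /deRham_diff1 /= PQ subrr. Qed.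

Definition poisson_complex : complex3 K :=
  @Complex3 K V (V * V)%type V poisson_diff0 poisson_diff1 poisson_diff_diff.
Definition deRham_complex : complex3 K :=
  @Complex3 K V (V * V)%type V deRham_diff0 deRham_diff1 deRham_diff_diff.
End LogComplexes.

Section PolyOperators.
Variable K : comNzRingType.
Local Notation A := {mpoly K[2]}.
Local Notation As := (fps A).
Local Notation ix := (ord0 : 'I_2).
Local Notation iy := (ord_max : 'I_2).

(* The derivations [E = x d/dx + y d/dy] and [R = y d/dy - x d/dx]. *)
Definition opE (f : A) : A := 'X_ix * f^`M(ix) + 'X_iy * f^`M(iy).
Definition opR (f : A) : A := 'X_iy * f^`M(iy) - 'X_ix * f^`M(ix).

Lemma opE_is_linear : linear opE.
Proof.
move=> a f g; rewrite /opE !mderivD !mderivZ !mulrDr -!scalerAr addrACA.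
by rewrite scalerDr.
Qed.
Lemma opR_is_linear : linear opR.
Proof.
move=> a f g; rewrite /opR !mderivD !mderivZ !mulrDr -!scalerAr scalerBr.
by rewrite opprD addrACA.
Qed.
HB.instance Definition _ := GRing.isLinear.Build K A A *:%R opE opE_is_linear.
HB.instance Definition _ := GRing.isLinear.Build K A A *:%R opR opR_is_linear.

Lemma mderivXi (i j : 'I_2) : ('X_i : A)^`M(j) = (i == j)%:R.
Proof.
rewrite mderivX mnm1E; case: eqP => [->|_]; last by rewrite scale0r.
rewrite scale1r (_ : (U_(j) - U_(j))%MM = 0%MM) ?mpolyX0 //.
by apply/mnmP => k; rewrite mnmBE subnn mnm0E.
Qed.

Lemma opRM f g : opR (f * g) = opR f * g + f * opR g.
Proof. by rewrite /opR !mderivM; ring. Qed.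

Lemma opER f : opE (opR f) = opR (opE f).
Proof.
rewrite /opE /opR !(mderivD, mderivN, mderivM, mderivXi) /=.
rewrite (mderiv_comm ix iy f); ring.
Qed.

Definition txy : A := 'X_ix * 'X_iy.

Lemma opR_txy : opR txy = 0.
Proof. by rewrite /opR /txy !mderivM !mderivXi /=; ring. Qed.

Lemma opR_txyX i f : opR (txy ^+ i * f) = txy ^+ i * opR f.
Proof.
rewrite opRM; suff -> : opR (txy ^+ i) = 0 by rewrite mul0r add0r.
elim: i => [|i IHi]; last by rewrite exprS opRM opR_txy IHi mul0r mulr0 addr0.
by rewrite expr0 /opR -mpolyC1 !mderivC !mulr0 subr0.
Qed.

(* [h_{s,t} = 1 + \sum_(i >= 1) s^i t^i], with [t = txy]. *)
Definition h_st : As := Fps (fun i => txy ^+ i).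

Definition opE_s : {linear As -> As} := fps_map opE.
Definition opR_s : {linear As -> As} := fps_map opR.
Definition hE (f : As) : As := h_st * opE_s f.

Lemma fps_scale_mul (a : fps K) (f : As) :
  a *: f = Fps (fun n => (fcoef a n)%:MP) * f.
Proof.
by apply/fpsP => n /=; apply: eq_bigr => i _; rewrite mul_mpolyC.
Qed.

Lemma hE_is_linear : linear hE.
Proof.
move=> a f g; rewrite /hE linearP mulrDr; congr (_ + _).
by rewrite !fps_scale_mul mulrCA.
Qed.
HB.instance Definition _ :=
  GRing.isLinear.Build (fps K) As As *:%R hE hE_is_linear.

Lemma hE_opR f : hE (opR_s f) = opR_s (hE f).
Proof.
apply/fpsP => n /=; rewrite linear_sum; apply: eq_bigr => i _ /=.
by rewrite opER opR_txyX.
Qed.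

Definition poisson_log0 : complex3 K := poisson_complex opER.
Definition deRham_log0 : complex3 K := deRham_complex opER.
Definition poisson_log_s : complex3 (fps K) := poisson_complex hE_opR.
Definition deRham_log_s : complex3 (fps K) := deRham_complex hE_opR.
End PolyOperators.

(* Main.v *)
(* The operator [E] multiplies a monomial by its degree, so it is invertible on
   the series without constant term in [x, y], and [R] kills constants. Hence
   constants account for all the cohomology, of dimension 1, 2, 1. The same holds
   after deformation: [h_{s,t}] is a unit, and multiplication by it preserves the
   series without constant term. All groups are thus free of equal finite ranks
   over [C] and [C[[s]]]. *)
Require Import Defs.
From HB Require Import structures.
From mathcomp Require Import all_boot all_algebra complex reals.
From mathcomp Require Import boolp mpoly.
Set Implicit Arguments.
Unset Strict Implicit.
Unset Printing Implicit Defensive.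
Import GRing.Theory Num.Theory.
Local Open Scope ring_scope.

(** * Isomorphisms of modules and recognition of homology groups *)

Section LmodIso.
Variable K : pzRingType.
Implicit Types V W U : lmodType K.

Lemma lmod_iso_sym V W : lmod_iso V W -> lmod_iso W V.
Proof.
move=> [u [v uK vK]].
have vL : linear v by move=> a x y; apply: (can_inj uK); rewrite linearP !vK.
pose v' : {linear W -> V} := HB.pack v (GRing.isLinear.Build _ _ _ _ _ vL).
by exists v', u.
Qed.

Lemma lmod_iso_trans V W U : lmod_iso V W -> lmod_iso W U -> lmod_iso V U.
Proof. by move=> [u bu] [v bv]; exists (v \o u); apply: bij_comp. Qed.
End LmodIso.

(** The first hypothesis lets [z] descend to homology; the second makes the induced map injective
    and the third makes it surjective. *)
Lemma homology_iso (K : pzRingType) (U V W N : lmodType K)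
    (d : {linear U -> V}) (d' : {linear V -> W}) (z : {linear V -> N}) :
    (forall u, z (d u) = 0) ->
    (forall v, d' v = 0 -> z v = 0 -> exists u, v = d u) ->
    (forall w, exists v, d' v = 0 /\ z v = w) ->
  lmod_iso (homology d d') N.
Proof.
move=> zd zker zsurj.
(* [g] reads [z] on a chosen representative; the choice is harmless because two representatives
   differ by a coboundary, which [z] kills. *)
pose g (q : homology d d') : N := z (val (repr q)).
have gE v : g (quotmod_pi _ v) = z (val v).
  apply/esym/eqP; rewrite /g -subr_eq0 -linearB -(raddfB val).
  set w := v - _; have /asboolP[u wE] : coboundary d w by exact: quotmod_reprP.
  by apply/eqP; rewrite -(zd u); congr (z _).
have gL : linear g.
  move=> a; elim/quotmod_piW => v; elim/quotmod_piW => w.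
  by rewrite -linearP !gE -linearP; congr (z _); exact: (linearP val).
pose g' : {linear homology d d' -> N} :=
  HB.pack g (GRing.isLinear.Build _ _ _ _ _ gL).
exists g'.
have /choice[f fP] w : exists q, g' q = w.
  have [v [d'v <-]] := zsurj w.
  have cv : v \in cocycle d' by rewrite -topredE /= /cocycle d'v.
  by exists (quotmod_pi _ (exist _ v cv : cocycles d')); exact: gE.
have g0 q : g' q = 0 -> q = 0.
  elim/quotmod_piW: q => v; rewrite /= gE => zv0.
  rewrite -(linear0 (quotmod_pi _)); apply/quotmod_piP; rewrite subr0.
  by apply/asboolP/zker => //; apply/eqP; exact: (valP v).
exists f => // q; apply/eqP; rewrite -subr_eq0; apply/eqP/g0.
by rewrite linearB fP subrr.
Qed.

(** * Extension of scalars of free modules *)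

Section BaseChangeFree.
Variables (K L : nzRingType) (phi : {rmorphism K -> L}) (M : lmodType K).

Lemma tensor_suml n (f : 'I_n -> M) a :
  tensor phi (\sum_i f i) a = \sum_i tensor phi (f i) a.
Proof.
have t0 : tensor phi (0 : M) a = 0.
  by apply: (addIr (tensor phi 0 a)); rewrite -tensorDl !add0r.
exact: (big_morph _ (fun m m' => tensorDl phi m m' a) t0).
Qed.

Lemma base_change_free n :
  lmod_iso M 'rV[K]_n -> lmod_iso (base_change phi M) 'rV[L]_n.
Proof.
move=> isoM; have [v [u vK uK]] := lmod_iso_sym isoM.
have uL : linear u by move=> a x y; apply: (can_inj vK); rewrite linearP !uK.
(* Coordinates pushed along [phi] form a [phi]-semilinear map, so the universal property yields the
   forward map [g]. *)
pose j m : 'rV[L]_n := map_mx phi (u m).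
have jL : linear_for (phi \; *:%R) j.
  by move=> a x y; rewrite /j uL; apply/rowP => i; rewrite !mxE rmorphD rmorphM.
pose J : {linear M -> 'rV[L]_n | phi \; *:%R} :=
  HB.pack j (GRing.isLinear.Build _ _ _ _ _ jL).
have [g gE _] := base_change_universal J.
pose e i : M := v (delta_mx 0 i).
have eE m : m = \sum_i u m 0 i *: e i.
  rewrite -{1}[m]uK {1}[u m]row_sum_delta linear_sum.
  by apply: eq_bigr => i _; rewrite linearZ.
exists g, (fun w : 'rV_n => \sum_i tensor phi (e i) (w 0 i)).
  (* Induction reduces this inverse law to pure tensors, where [m] is expanded in the basis [e] and
     its coordinates move across the tensor sign. *)
  apply: base_change_ind => [|m a x {2}<-].
    rewrite linear0 big1 // => i _.
    by rewrite mxE tensor1 scale0r.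
  rewrite linearD /= gE {2}[m]eE tensor_suml -big_split /=.
  by apply: eq_bigr => i _; rewrite !mxE tensorDr tensorZl.
move=> w; rewrite linear_sum [RHS]row_sum_delta; apply: eq_bigr => i _.
rewrite gE /= /j /e vK; congr (_ *: _).
by apply/rowP => k; rewrite !mxE rmorph_nat.
Qed.
End BaseChangeFree.

(** * Cohomology of an abstract logarithmic complex *)

Definition betti (k : 'I_3) : nat := if val k == 1%N then 2 else 1.

Section LogCohomology.
Variables (K : nzRingType) (V : lmodType K) (P Q : {linear V -> V}).
Hypothesis PQ : forall f, P (Q f) = Q (P f).
(** Abstract setting covering both scalar rings: [c] stands for the constant coefficient, [e] for
    the constant 1, and [P] restricts to a bijection of the kernel of [c]. *)
Variables (c : {linear V -> K^o}) (e : V).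
Hypotheses (ce : c e = 1) (Pe : P e = 0) (Qe : Q e = 0).
Hypotheses (cP : forall f, c (P f) = 0) (cQ : forall f, c (Q f) = 0).
Hypothesis P_inj : forall f, P f = 0 -> c f = 0 -> f = 0.
Hypothesis P_surj : forall f, c f = 0 -> exists u, P u = f.

Definition coord1 (f : V) : 'rV[K]_1 := const_mx (c f).
Definition coord2 (ab : V * V) : 'rV[K]_2 :=
  \row_i if i == 0 then c ab.1 else c ab.2.

Lemma coord1_is_linear : linear coord1.
Proof. by move=> a f g; apply/rowP => i; rewrite !mxE linearP. Qed.
Lemma coord2_is_linear : linear coord2.
Proof. by move=> a f g; apply/rowP => i; rewrite !mxE; case: ifP; rewrite linearP. Qed.
HB.instance Definition _ :=
  GRing.isLinear.Build K V 'rV[K]_1 *:%R coord1 coord1_is_linear.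
HB.instance Definition _ :=
  GRing.isLinear.Build K (V * V)%type 'rV[K]_2 *:%R coord2 coord2_is_linear.

Lemma coord1_eq0 f : coord1 f = 0 <-> c f = 0.
Proof.
split=> [/rowP/(_ 0)|cf]; first by rewrite !mxE.
by apply/rowP => i; rewrite !mxE.
Qed.

Lemma coord2_eq0 ab : coord2 ab = 0 <-> c ab.1 = 0 /\ c ab.2 = 0.
Proof.
split=> [/rowP z|[z1 z2]]; last by apply/rowP => i; rewrite !mxE z1 z2 if_same.
by split; [move: (z 0) | move: (z 1)]; rewrite !mxE.
Qed.

Lemma coord1_surj (w : 'rV[K]_1) : coord1 (w 0 0 *: e) = w.
Proof. by apply/rowP => i; rewrite !mxE linearZ /= ce (ord1 i) -[RHS]mulr1. Qed.

Lemma coord2_surj (w : 'rV[K]_2) : coord2 (w 0 0 *: e, w 0 1 *: e) = w.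
Proof.
apply/rowP => i; rewrite !mxE !linearZ /= ce.
case: eqVneq => [->|]; first exact: mulr1.
by case: i => -[|[|]] // i2 _; apply: etrans (mulr1 _) _; congr (w _ _); apply/val_inj.
Qed.

(** Subtracting [c u *: e], which [P] kills, moves a preimage into the kernel of [c] without
    changing its image. *)
Lemma P_surj0 f : c f = 0 -> exists u, P u = f /\ c u = 0.
Proof.
move=> /P_surj[u <-]; exists (u - c u *: e).
by split; rewrite linearB linearZ /= ?Pe ?scaler0 ?subr0 // ce [_ *: _]mulr1 subrr.
Qed.

(* With [a = P f], [P (b - Q f) = 0], so [b = Q f] by injectivity of [P] on
   [ker c]. *)
Lemma koszul_exact a b :
  P b = Q a -> c a = 0 -> c b = 0 -> exists f, a = P f /\ b = Q f.
Proof.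
move=> PbQa /P_surj0[f [aE cf]] cb; exists f; split=> //.
apply/eqP; rewrite -subr_eq0; apply/eqP/P_inj.
  by rewrite linearB /= PbQa PQ aE subrr.
by rewrite linearB /= cb cQ subr0.
Qed.

(** The invariants are [coord1] in degrees 0 and 2 and [coord2] in degree 1. The nine goals are the
    three conditions of [homology_iso], degree by degree. *)
Lemma cohomology_poisson k :
  lmod_iso (cohomology (poisson_complex PQ) k) 'rV[K]_(betti k).
Proof.
case: k => -[|[|[|]]] //= ?; rewrite /cohomology /betti /=;
  [apply: (homology_iso (z := coord1)) | apply: (homology_iso (z := coord2))
  | apply: (homology_iso (z := coord1))].
- by move=> u; exact/linear0.
- move=> f [_ /eqP]; rewrite oppr_eq0 => /eqP Pf /coord1_eq0 cf.
  by exists 0; rewrite (P_inj Pf cf) linear0.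
- move=> w; exists (w 0 0 *: e); split; last exact: coord1_surj.
  by rewrite /= /poisson_diff0 !linearZ /= Pe Qe oppr0 !scaler0.
- by move=> u; apply/coord2_eq0; rewrite /= linearN /= cP cQ oppr0.
- move=> [a b] /= dab /coord2_eq0[/= ca cb].
  (* The sign in the Poisson differential is absorbed by applying exactness to the pair [- b],
     [a]. *)
  have PaQb : P a = Q (- b).
    by apply/eqP; rewrite linearN -addr_eq0; apply/eqP.
  have cNb : c (- b) = 0 by rewrite linearN cb oppr0.
  have [f [bE aE]] := koszul_exact PaQb cNb ca.
  by exists f; rewrite /= /poisson_diff0 -aE -bE opprK.
- move=> w; exists (w 0 0 *: e, w 0 1 *: e); split; last exact: coord2_surj.
  by rewrite /= /poisson_diff1 /= !linearZ /= Pe Qe !scaler0 addr0.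
- by move=> u; apply/coord1_eq0; rewrite /= /poisson_diff1 linearD /= cP cQ addr0.
(* In top degree [P] alone already reaches the whole kernel of [c]. *)
- move=> f _ /coord1_eq0 /P_surj[u <-]; exists (u, 0).
  by rewrite /= /poisson_diff1 /= linear0 addr0.
- by move=> w; exists (w 0 0 *: e); split; last exact: coord1_surj.
Qed.

(** Same scheme as for the Poisson complex; here the degree 1 cocycle condition is literally the
    hypothesis of [koszul_exact]. *)
Lemma cohomology_deRham k :
  lmod_iso (cohomology (deRham_complex PQ) k) 'rV[K]_(betti k).
Proof.
case: k => -[|[|[|]]] //= ?; rewrite /cohomology /betti /=;
  [apply: (homology_iso (z := coord1)) | apply: (homology_iso (z := coord2))
  | apply: (homology_iso (z := coord1))].
- by move=> u; exact/linear0.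
- move=> f [Pf _] /coord1_eq0 cf.
  by exists 0; rewrite (P_inj Pf cf) linear0.
- move=> w; exists (w 0 0 *: e); split; last exact: coord1_surj.
  by rewrite /= /deRham_diff0 !linearZ /= Pe Qe !scaler0.
- by move=> u; apply/coord2_eq0; rewrite /= cP cQ.
- move=> [a b] /= /eqP; rewrite /deRham_diff1 /= subr_eq0 => /eqP PbQa.
  move=> /coord2_eq0[/= ca cb].
  have [f [-> ->]] := koszul_exact PbQa ca cb.
  by exists f.
- move=> w; exists (w 0 0 *: e, w 0 1 *: e); split; last exact: coord2_surj.
  by rewrite /= /deRham_diff1 /= !linearZ /= Pe Qe !(oppr0, scaler0, addr0).
- by move=> u; apply/coord1_eq0; rewrite /= /deRham_diff1 (linearB c) /= cP cQ subrr.
- move=> f _ /coord1_eq0 /P_surj[u <-]; exists (0, u).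
  by rewrite /= /deRham_diff1 /= linear0 subr0.
- by move=> w; exists (w 0 0 *: e); split; last exact: coord1_surj.
Qed.
End LogCohomology.

(** * The operators [E], [R] and [hE] on polynomials and on series *)

Section Operators.
Variable K : numFieldType.
Local Notation A := {mpoly K[2]}.
Local Notation As := (fps A).
Implicit Types (f g : A) (F G : As).

Definition const_coef (f : A) : K^o := f@_0%MM.
Lemma const_coef_is_linear : linear const_coef.
Proof. by move=> a f g; rewrite /const_coef linearP. Qed.
HB.instance Definition _ :=
  GRing.isLinear.Build K A K^o *:%R const_coef const_coef_is_linear.

Lemma const_coefM f g : const_coef (f * g) = const_coef f * const_coef g.
Proof. exact: (rmorphM (mcoeff 0%MM)). Qed.

Lemma const_coef1 : const_coef 1 = 1.
Proof. by rewrite /const_coef mcoeff1 eqxx. Qed.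

Lemma const_coefX i : const_coef 'X_i = 0.
Proof. by rewrite /const_coef mcoeffX mnm1_eq0. Qed.

(** Each term carries a factor ['X_i], and the constant coefficient is multiplicative. *)
Lemma const_coef_opE f : const_coef (opE f) = 0.
Proof. by rewrite linearD /= !const_coefM !const_coefX !mul0r addr0. Qed.

Lemma const_coef_opR f : const_coef (opR f) = 0.
Proof. by rewrite linearB /= !const_coefM !const_coefX !mul0r subr0. Qed.

Lemma opE_1 : opE (1 : A) = 0.
Proof. by rewrite /opE -mpolyC1 !mderivC !mulr0 addr0. Qed.

Lemma opR_1 : opR (1 : A) = 0.
Proof. by rewrite /opR -mpolyC1 !mderivC !mulr0 subr0. Qed.

Lemma mulX_mderivX i m : 'X_i * ('X_[m] : A)^`M(i) = (m i)%:R *: 'X_[m].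
Proof.
(* When [m i = 0] the truncated subtraction of exponents cannot be undone, but both sides then have
   coefficient 0. *)
rewrite mderivX -scalerAr -mpolyXD; have [->|mi] := eqVneq (m i) 0%N.
  by rewrite !scale0r.
by congr (_ *: 'X_[_]); rewrite addmC submK // lep1mP.
Qed.

(** Euler's identity for monomials. *)
Lemma opE_X m : opE ('X_[m] : A) = (mdeg m)%:R *: 'X_[m].
Proof.
rewrite /opE !mulX_mderivX -scalerDl -natrD mdegE big_ord_recl big_ord1.
by congr ((_ + m _)%:R *: _); apply/val_inj.
Qed.

Lemma mcoeff_opE f m : (opE f)@_m = (mdeg m)%:R * f@_m.
Proof.
rewrite {1 2}[f]mpolyE (linear_sum (@opE K)) !(linear_sum (mcoeff m)) mulr_sumr /=.
apply: eq_bigr => m' _; rewrite linearZ /= opE_X !mcoeffZ mcoeffX mulrCA.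
by case: eqP => [->//|_]; rewrite !mulr0.
Qed.

(** Each coefficient is multiplied by the degree of its monomial, which in characteristic 0 vanishes
    only for the constant monomial. *)
Lemma opE_inj f : opE f = 0 -> const_coef f = 0 -> f = 0.
Proof.
move=> Ef f0; apply/mpolyP => m; rewrite mcoeff0.
have [->//|m0] := eqVneq m 0%MM.
have /esym/eqP := mcoeff_opE f m.
by rewrite Ef mcoeff0 mulf_eq0 pnatr_eq0 mdeg_eq0 (negPf m0) => /eqP.
Qed.

Lemma opE_surj f : const_coef f = 0 -> exists u, opE u = f.
Proof.
(* Each coefficient is divided by its degree; this is legitimate because [f0] keeps the constant
   monomial out of the support. *)
move=> f0; exists (\sum_(m <- msupp f) ((mdeg m)%:R^-1 * f@_m) *: 'X_[m]).
rewrite [RHS]mpolyE linear_sum; apply: eq_big_seq => m; rewrite mcoeff_msupp => fm.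
rewrite linearZ /= opE_X scalerA mulrAC mulVf ?mul1r // pnatr_eq0 mdeg_eq0.
by apply: contraNneq fm => ->; apply/eqP.
Qed.

Definition const_coef_s F : (fps K)^o := Fps (fun n => const_coef (fcoef F n)).
Lemma const_coef_s_is_linear : linear const_coef_s.
Proof. exact: (fps_map_is_linear const_coef). Qed.
HB.instance Definition _ := GRing.isLinear.Build (fps K) As (fps K)^o *:%R
  const_coef_s const_coef_s_is_linear.

Lemma const_coef_sM F G : const_coef_s (F * G) = const_coef_s F * const_coef_s G.
Proof.
apply/fpsP => n /=; rewrite linear_sum; apply: eq_bigr => i _.
exact: const_coefM.
Qed.

Lemma const_coef_s_eq0 F :
  const_coef_s F = 0 <-> forall n, const_coef (fcoef F n) = 0.
Proof. by split=> [/fpsP cf n|cf]; [exact: cf | apply/fpsP => n; exact: cf]. Qed.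

Lemma const_coef_hE F : const_coef_s (hE F) = 0.
Proof.
rewrite const_coef_sM (_ : const_coef_s (opE_s K F) = 0) ?mulr0 //.
by apply/const_coef_s_eq0 => n; exact: const_coef_opE.
Qed.

Lemma const_coef_opR_s F : const_coef_s (opR_s K F) = 0.
Proof. by apply/const_coef_s_eq0 => n; exact: const_coef_opR. Qed.

Lemma const_coef_s1 : const_coef_s 1 = 1.
Proof.
by apply/fpsP => n /=; case: eqP => _; [exact: const_coef1 | exact: linear0].
Qed.

Lemma opE_s1 : opE_s K 1 = 0.
Proof. by apply/fpsP => -[|n] /=; rewrite ?opE_1 ?linear0. Qed.

Lemma opR_s1 : opR_s K 1 = 0.
Proof. by apply/fpsP => -[|n] /=; rewrite ?opR_1 ?linear0. Qed.

(* [h_{s,t}] is the geometric series in [s t], so its inverse is [1 - s t]. *)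
Definition h_st_inv : As :=
  Fps (fun n => match n with 0 => 1 | 1 => - txy K | _ => 0 end).

Lemma h_st_invK : h_st_inv * h_st K = 1.
Proof.
apply/fpsP => -[|n] /=; first by rewrite big_ord1 mul1r.
(* Only the first two terms of the convolution survive, and they cancel: [t^(n+1) - t * t^n]. *)
rewrite !big_ord_recl /= big1 => [|i _]; last by rewrite mul0r.
by rewrite addr0 mul1r subn0 subn1 mulNr -exprS subrr.
Qed.

Lemma hE_1 : hE (1 : As) = 0.
Proof. by rewrite /hE opE_s1 mulr0. Qed.

(** Cancelling the unit [h_st] leaves the injectivity of [E] in each power of [s]. *)
Lemma hE_inj F : hE F = 0 -> const_coef_s F = 0 -> F = 0.
Proof.
move=> /(congr1 ( *%R h_st_inv)); rewrite mulrA h_st_invK mul1r mulr0.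
move=> /fpsP Ef /const_coef_s_eq0 cf; apply/fpsP => n.
by apply: opE_inj; [exact: Ef | exact: cf].
Qed.

Lemma hE_surj F : const_coef_s F = 0 -> exists u, hE u = F.
Proof.
(* Dividing by [h_st] keeps the constant coefficients zero, so [E] can be inverted separately in
   each power of [s]. *)
move=> cf; have /const_coef_s_eq0 cgf : const_coef_s (h_st_inv * F) = 0.
  by rewrite const_coef_sM cf mulr0.
have /choice[u uP] n := opE_surj (cgf n).
exists (Fps u); rewrite /hE (_ : opE_s K (Fps u) = h_st_inv * F).
  by rewrite mulrA [h_st K * _]mulrC h_st_invK mul1r.
by apply/fpsP => n; exact: uP.
Qed.

(** * The four logarithmic complexes and the comparison *)

Lemma cohomology_poisson_log0 k :
  lmod_iso (cohomology (poisson_log0 K) k) 'rV[K]_(betti k).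
Proof.
apply: (cohomology_poisson (@opER K) (c := const_coef) (e := 1)).
- exact: const_coef1.
- exact: opE_1.
- exact: opR_1.
- exact: const_coef_opE.
- exact: const_coef_opR.
- exact: opE_inj.
- exact: opE_surj.
Qed.

Lemma cohomology_poisson_log_s k :
  lmod_iso (cohomology (poisson_log_s K) k) 'rV[fps K]_(betti k).
Proof.
apply: (cohomology_poisson (@hE_opR K) (c := const_coef_s) (e := 1)).
- exact: const_coef_s1.
- exact: hE_1.
- exact: opR_s1.
- exact: const_coef_hE.
- exact: const_coef_opR_s.
- exact: hE_inj.
- exact: hE_surj.
Qed.

Lemma cohomology_deRham_log0 k :
  lmod_iso (cohomology (deRham_log0 K) k) 'rV[K]_(betti k).
Proof.
apply: (cohomology_deRham (@opER K) (c := const_coef) (e := 1)).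
- exact: const_coef1.
- exact: opE_1.
- exact: opR_1.
- exact: const_coef_opE.
- exact: const_coef_opR.
- exact: opE_inj.
- exact: opE_surj.
Qed.

Lemma cohomology_deRham_log_s k :
  lmod_iso (cohomology (deRham_log_s K) k) 'rV[fps K]_(betti k).
Proof.
apply: (cohomology_deRham (@hE_opR K) (c := const_coef_s) (e := 1)).
- exact: const_coef_s1.
- exact: hE_1.
- exact: opR_s1.
- exact: const_coef_hE.
- exact: const_coef_opR_s.
- exact: hE_inj.
- exact: hE_surj.
Qed.

End Operators.

Theorem corollary5p28 (R : realType) (k : 'I_3) :
  lmod_iso (cohomology (poisson_log_s R[i]) k)
           (base_change (@fpsC R[i]) (cohomology (poisson_log0 R[i]) k)) /\
  lmod_iso (cohomology (deRham_log_s R[i]) k)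
           (base_change (@fpsC R[i]) (cohomology (deRham_log0 R[i]) k)).
Proof.
split.
(* Both sides are compared with the free [C[[s]]]-module of rank [betti k]: the deformed group
   directly, the undeformed one after extending scalars along [fpsC]. *)
- apply: lmod_iso_trans (cohomology_poisson_log_s _ k) _.
  by apply/lmod_iso_sym/base_change_free/cohomology_poisson_log0.
- apply: lmod_iso_trans (cohomology_deRham_log_s _ k) _.
  by apply/lmod_iso_sym/base_change_free/cohomology_deRham_log0.
Qed.
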